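(* Let $G$ be a finite non-nilpotent group. Then the graph $\mathfrak{N}_G$ is connected and its diameter is at most $6$. In particular, every two vertices $x$ and $y$ of $\mathfrak{N}_G$ with $\pi(x)\neq\pi(y)$ are connected by a path of length at most $4$ in $\mathfrak{N}_G$.
   Context: For a group $G$, $nil(G)=\{x\in G \mid \langle x,y\rangle \text{ is nilpotent for all } y\in G\}$. The graph $\mathfrak{N}_G$ is the simple graph with vertex set $G\setminus nil(G)$ in which two distinct vertices $x,y$ are adjacent if and only if $\langle x,y\rangle$ is not nilpotent. For an element $x$ of a finite group, $\pi(x)$ denotes the set of primes dividing the order $|x|$ of $x$. The length of a path $v_0-v_1-\cdots-v_k$ is $k$; the diameter of a connected graph is the largest distance between pairs of vertices. *)

(* Defs.v *)
From mathcomp Require Import all_boot all_fingroup all_solvable.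

Set Implicit Arguments.
Unset Strict Implicit.
Unset Printing Implicit Defensive.

Local Open Scope group_scope.

Record sgraph (T : finType) := SGraph {
  vertices : {set T};
  adj : rel T;
  adj_vertices : forall x y, adj x y -> (x \in vertices) && (y \in vertices);
  adj_sym : symmetric adj;
  adj_irr : irreflexive adj
}.

Section GraphNotions.
Variables (T : finType) (Gr : sgraph T).

(* As in [path.v], the path x - v_1 - ... - v_k = y is given by its start x and
   the sequence p = [:: v_1; ...; v_k], so that its length is [size p]. All its
   vertices are in [vertices Gr], by [adj_vertices]. *)
Definition gpath (x y : T) (p : seq T) : bool :=
  [&& x \in vertices Gr, path (adj Gr) x p, last x p == y & uniq (x :: p)].

Definition connected : Prop :=
  vertices Gr != set0
  /\ {in vertices Gr &, forall x y, exists p : seq T, gpath x y p}.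

(* The least length of a path from x to y. A path has fewer than #|T| edges;
   #|T| is a junk value, returned when no path exists. *)
Definition dist (x y : T) : nat :=
  find (fun k => [exists p : k.-tuple T, gpath x y p]) (iota 0 #|T|).

Definition diameter : nat :=
  \max_(x in vertices Gr) \max_(y in vertices Gr) dist x y.

End GraphNotions.

Section NonNilpotentGraph.
Variables (gT : finGroupType) (G : {group gT}).

Definition nil : {set gT} :=
  [set x in G | [forall y in G, nilpotent <<[set x; y]>>]].

Definition nn_adj : rel gT := fun x y =>
  [&& x \in G :\: nil, y \in G :\: nil, x != y & ~~ nilpotent <<[set x; y]>>].

Fact nn_adj_vertices x y :
  nn_adj x y -> (x \in G :\: nil) && (y \in G :\: nil).
Proof. by case/and4P=> -> ->. Qed.

Fact nn_adj_sym : symmetric nn_adj.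
Proof. by move=> x y; rewrite /nn_adj andbCA eq_sym setUC. Qed.

Fact nn_adj_irr : irreflexive nn_adj.
Proof. by move=> x; rewrite /nn_adj eqxx !andbF. Qed.

Definition nn_graph : sgraph gT := SGraph nn_adj_vertices nn_adj_sym nn_adj_irr.

End NonNilpotentGraph.

(* Main.v *)
Require Import Defs.
From mathcomp Require Import all_boot all_fingroup all_solvable.

Set Implicit Arguments.
Unset Strict Implicit.
Unset Printing Implicit Defensive.

Local Open Scope group_scope.

(** If all the primary parts of x centralize the elements of coprime order, then
x is in nil(G). Hence every vertex x has a neighbour c of r-power order which
does not commute with the p-part x_p for some prime p <> r; let (y, q, d, s) be
the corresponding data for a second vertex y. If p <> s, then either x_p and d
do not commute and x - d - y is a path, or x_p d has both x_p and d as powers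
and x - c - x_p d - y is a path. The case q <> r is symmetric. Otherwise
p = s <> r = q, and either x_p and y_q do not commute, so that x and y are
adjacent, or x - c - x_p y_q - d - y is a path. Thus the diameter is at most
4. *)

Section PrimaryParts.
Variable gT : finGroupType.
Implicit Types (G H : {group gT}) (x y z : gT) (p q : nat).

Lemma constt_mem_group G x :
  (forall p, p \in index_iota 0 #[x].+1 -> x.`_p \in G) -> x \in G.
Proof.
move=> Gx; rewrite -(prod_constt x) big_seq.
by elim/big_rec: _ => // p y px Gy; rewrite groupM ?Gx.
Qed.

Lemma p'_elt_of_neq x p q : p != q -> q.-elt x -> p^'.-elt x.
Proof.
move=> neq_pq; apply: sub_in_pnat => r _ /eqnP ->.
by rewrite !inE eq_sym.
Qed.

(** In a nilpotent group, cyclic subgroups of coprime orders centralize each other. *)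
Lemma nonnil_of_noncommuting H x y p :
    p.-elt x -> p^'.-elt y -> x \in H -> y \in H -> ~ commute x y ->
  ~~ nilpotent H.
Proof.
move=> px p'y Hx Hy ncxy; apply/negP => nilH; apply: ncxy.
apply/cent1P; rewrite cent1C -cent_cycle -cycle_subG.
rewrite (sub_nilpotent_cent2 nilH) ?cycle_subG //.
exact: pnat_coprime px p'y.
Qed.

(** For a prime p this is the centralizer in G of O^p(G), which the p'-elements of G generate. *)
Definition p'_cent G p : {set gT} := 'C_G([set z in G | p^'.-elt z]).

Canonical p'_cent_group G p := Eval hnf in [group of p'_cent G p].

Lemma p'_cent_normal G p : p'_cent G p <| G.
Proof.
rewrite /normal subsetIl /= normsI ?normG ?norms_cent //.
apply/subsetP=> g Gg; rewrite inE; apply/subsetP=> _ /imsetP[z + ->].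
by rewrite !inE p_eltJ => /andP[Gz ->]; rewrite groupJ.
Qed.

(** The p'-part of an element of [B] is one of the elements that [B] centralizes, so it lies in
    ['Z(B)]. Hence the quotient of [B] by its center is a p-group. *)
Lemma p'_cent_nil G p : nilpotent (p'_cent G p).
Proof.
set B := p'_cent G p.
rewrite -(quotient_center_nil B) (@pgroup_nil _ p) //.
apply/pgroupP => r pr_r /Cauchy[] // zb /morphimP[z nBz Bz ->] oz.
suffices: p.-elt (coset 'Z(B) z) by rewrite /p_elt oz pnatE.
rewrite -p_eltNK; apply/constt1P; rewrite -morph_constt //= coset_id //.
have Gz': z.`_p^' \in [set z in G | p^'.-elt z].
  by rewrite inE p_elt_constt groupX //; case/setIP: Bz.
rewrite /center inE groupX //=; apply/centP => b /setIP[_ /centP cb].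
by apply/commute_sym/cb.
Qed.

Lemma p'_cent_pcore_normal G p : 'O_p(p'_cent G p) <| G.
Proof. exact: char_normal_trans (pcore_char _ _) (p'_cent_normal G p). Qed.

Lemma p'_cent_constt G x p : x.`_p \in p'_cent G p -> x.`_p \in 'O_p(p'_cent G p).
Proof.
move=> cx; have hallB := nilpotent_pcore_Hall p (p'_cent_nil G p).
by rewrite (mem_Hall_pcore hallB) ?p_elt_constt.
Qed.

Lemma p'_cent_gen_nil x y :
    let H := <<[set x; y]>>%G in
    (forall p, p \in index_iota 0 #[x].+1 -> x.`_p \in p'_cent H p) ->
  nilpotent <<[set x; y]>>.
Proof.
move=> H cx.
have [Hx Hy]: x \in H /\ y \in H by split; rewrite mem_gen // !inE eqxx ?orbT.
pose A p := 'O_p(p'_cent H p).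
pose N p := (A p <*> <[y.`_p]>)%G.
have nAH p : H \subset 'N(A p) by apply/normal_norm/p'_cent_pcore_normal.
have pN p : p.-group (N p).
  rewrite /N /= norm_joinEr ?cycle_subG; last first.
    by apply: (subsetP (nAH p)); rewrite groupX.
  by rewrite pgroupM pcore_pgroup [p.-group _]p_elt_constt.
have sNH p : N p \subset H.
  rewrite join_subG cycle_subG groupX // andbT.
  exact/normal_sub/p'_cent_pcore_normal.
have nyN p : y \in 'N(N p).
  rewrite -cycle_subG normsY ?(subset_trans _ (nAH p)) ?cycle_subG //.
  rewrite -cycle_subG cents_norm // cent_cycle cycle_subG.
  exact/cent1P/(@commuteX _ y y).
have nxN p : x \in 'N(N p).
  apply: constt_mem_group => q xq.
  have [<- | neq_qp] := eqVneq q p.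
    apply: (subsetP (normG (N q))).
    by rewrite (subsetP (joing_subl _ _)) ?p'_cent_constt ?cx.
  rewrite -cycle_subG normsY ?(subset_trans _ (nAH p)) //.
    by rewrite cycle_subG groupX.
  rewrite cents_norm // cent_cycle cycle_subG.
  have /setIP[_ /centP cxq] := cx q xq.
  apply/cent1P/cxq; rewrite inE groupX //=.
  exact: p'_elt_of_neq neq_qp (p_elt_constt p y).
have sNF p : N p \subset 'F(H).
  rewrite Fitting_max ?(pgroup_nil (pN p)) // /normal sNH gen_subG.
  by rewrite subUset !sub1set nxN nyN.
apply: nilpotentS (Fitting_nil H); rewrite gen_subG subUset !sub1set.
apply/andP; split; apply: constt_mem_group => p xp; apply: (subsetP (sNF p)).
  by rewrite (subsetP (joing_subl _ _)) ?p'_cent_constt ?cx.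
by rewrite (subsetP (joing_subr _ _)) ?cycle_id.
Qed.

End PrimaryParts.

Section NonNilpotentPaths.
Variables (gT : finGroupType) (G : {group gT}).
Implicit Types (x y z : gT) (p q : nat).
Local Notation Gamma := (nn_graph G).

(** Non-commuting powers of x and y of coprime orders make [<<[set x; y]>>] non-nilpotent. This also
    keeps x and y out of [nil G], and apart, since a cyclic group is nilpotent. *)
Lemma nn_adjI x y a b p q :
    x \in G -> y \in G -> p != q -> p.-elt a -> q.-elt b ->
  a \in <[x]> -> b \in <[y]> -> ~ commute a b -> nn_adj G x y.
Proof.
move=> Gx Gy neq_pq pa qb xa yb ncab.
have nnil: ~~ nilpotent <<[set x; y]>>.
  have sub z : z \in [set x; y] -> <[z]> \subset <<[set x; y]>>.
    by move=> xyz; rewrite cycle_subG mem_gen.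
  apply: (nonnil_of_noncommuting pa (p'_elt_of_neq neq_pq qb) _ _ ncab).
    by apply: subsetP xa; rewrite sub ?inE ?eqxx.
  by apply: subsetP yb; rewrite sub ?inE ?eqxx ?orbT.
rewrite /nn_adj !inE Gx Gy !andbT /= nnil andbT.
apply/and3P; split.
- by apply: contra nnil => /forall_inP/(_ y Gy).
- by apply: contra nnil => /forall_inP/(_ x Gx); rewrite setUC.
apply: contraNneq nnil => <-; rewrite setUid abelian_nil //.
exact: cycle_abelian.
Qed.

Lemma gpath_of_path x s :
    x \in G :\: nil G -> path (nn_adj G) x s ->
  exists2 s', gpath Gamma x (last x s) s' & (size s' <= size s)%N.
Proof.
move=> Vx /shortenP[s' xs' Us' s's]; exists s'.
  by apply/and4P; split.
by apply: uniq_leq_size; [case/andP: Us' | ].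
Qed.

Lemma dist_le x y s n :
  gpath Gamma x y s -> (size s <= n)%N -> (dist Gamma x y <= n)%N.
Proof.
move=> xys; apply: leq_trans.
(* As the vertices are distinct, the length of [s] lies in the range that [dist] searches. *)
have lt_sT: (size s < #|gT|)%N.
  by case/and4P: xys => _ _ _ /card_uniqP /= <-; apply: max_card.
rewrite leqNgt; apply/negP => lt_sd; have:= before_find 0%N lt_sd.
rewrite nth_iota // add0n => /existsP[].
by exists (in_tuple s).
Qed.

Lemma nonnil_neighbour x :
  x \in G :\: nil G ->
  exists p q c, [/\ p != q, q.-elt c, c \in G & ~ commute x.`_p c].
Proof.
rewrite !inE => /andP[+ Gx]; rewrite Gx /= => /forall_inPn[y Gy nnil].
set H := <<[set x; y]>>%G.
have sHG: H \subset G by rewrite gen_subG subUset !sub1set Gx.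
have Hx: x \in H by rewrite mem_gen ?inE ?eqxx.
have: ~~ all (fun p => x.`_p \in p'_cent H p) (index_iota 0 #[x].+1).
  by apply: contra nnil => /allP; apply: p'_cent_gen_nil.
case/allPn=> p _; rewrite inE groupX //= -sub1set centsC.
case/subsetPn=> z; rewrite inE => /andP[Hz p'z]; rewrite cent_set1 => ncz.
(* If [x.]_p[commuted with every primary part of z, it would commute with z. The part found has q <>
   p because]z.[_p] is trivial. *)
have: ~~ all (fun q => z.`_q \in 'C[x.`_p]) (index_iota 0 #[z].+1).
  by apply: contra ncz => /allP; apply: constt_mem_group.
case/allPn=> q _ ncq; exists p, q, z.`_q; split; last 1 first.
- by move=> cxz; case/negP: ncq; apply/cent1P.
- by apply: contraNneq ncq => <-; rewrite (constt1P _) ?group1.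
- exact: p_elt_constt.
by apply: (subsetP sHG); rewrite groupX.
Qed.

(** The factors are the p-part and the p'-part of [a * b], hence powers of it. *)
Lemma prod_cycle_mem p q (a b : gT) :
    p != q -> p.-elt a -> q.-elt b -> commute a b ->
  a \in <[a * b]> /\ b \in <[a * b]>.
Proof.
move=> neq_pq pa qb cab.
have {}qb := p'_elt_of_neq neq_pq qb.
have a_p: (a * b).`_p = a.
  by rewrite consttM // (constt_p_elt pa) (constt1P qb) mulg1.
have b_p': (a * b).`_p^' = b.
  rewrite consttM // (constt_p_elt qb) (constt1P (x := a) _) ?mul1g //.
  by rewrite p_eltNK.
by split; [rewrite -{1}a_p | rewrite -{1}b_p']; apply: cycle_constt.
Qed.

Lemma short_path x y :
    x \in G :\: nil G -> y \in G :\: nil G ->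
  exists2 p : seq gT, gpath Gamma x y p & (size p <= 4)%N.
Proof.
move=> Vx Vy.
have [[Gx _] [Gy _]] := (setDP Vx, setDP Vy).
(* Repetitions are allowed in [s], as [a * b] below may equal x, for instance; [gpath_of_path]
   removes them. *)
suffices [s [xs <- s4]]: exists s, [/\ path (nn_adj G) x s, last x s = y & (size s <= 4)%N].
  by have [p' ? le] := gpath_of_path Vx xs; exists p' => //; apply: leq_trans s4.
have [p [r [c [neq_pr rc Gc ncx]]]] := nonnil_neighbour Vx.
have [q [t [d [neq_qt td Gd ncy]]]] := nonnil_neighbour Vy.
set a := x.`_p in ncx; set b := y.`_q in ncy.
have [pa qb]: p.-elt a /\ q.-elt b by rewrite !p_elt_constt.
have [xa yb]: a \in <[x]> /\ b \in <[y]> by rewrite !cycle_constt.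
have [Ga Gb]: a \in G /\ b \in G by rewrite !groupX.
have adjxc: nn_adj G x c.
  exact: (nn_adjI Gx Gc neq_pr pa rc xa (cycle_id c) ncx).
have adjdy: nn_adj G d y.
  by rewrite nn_adj_sym; apply: (nn_adjI Gy Gd neq_qt qb td yb (cycle_id d) ncy).
have commuteVP (u v : gT) : commute u v \/ ~ commute u v.
  by case: (u * v =P v * u); [left | right].
(* If a and d commute, [a * d] is adjacent to c through a and to y through d. *)
have [eq_pt | neq_pt] := eqVneq p t; last first.
  have [cad | ncad] := commuteVP a d; last first.
    exists [:: d; y]; rewrite /= adjdy !andbT; split=> //.
    exact: (nn_adjI Gx Gd neq_pt pa td xa (cycle_id d) ncad).
  have [ad_a ad_d] := prod_cycle_mem neq_pt pa td cad.
  exists [:: c; a * d; y]; rewrite /= adjxc; split=> //.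
  rewrite nn_adj_sym (nn_adjI (groupM Ga Gd) Gc neq_pr pa rc ad_a (cycle_id c) ncx).
  by rewrite nn_adj_sym (nn_adjI Gy (groupM Ga Gd) neq_qt qb td yb ad_d ncy).
have [eq_qr | neq_qr] := eqVneq q r; last first.
  have [cbc | ncbc] := commuteVP b c; last first.
    exists [:: c; y]; rewrite /= adjxc; split=> //.
    by rewrite nn_adj_sym (nn_adjI Gy Gc neq_qr qb rc yb (cycle_id c) ncbc).
  have [bc_b bc_c] := prod_cycle_mem neq_qr qb rc cbc.
  exists [:: b * c; d; y]; rewrite /= adjdy !andbT; split=> //.
  rewrite (nn_adjI Gx (groupM Gb Gc) neq_pr pa rc xa bc_c ncx).
  by rewrite (nn_adjI (groupM Gb Gc) Gd neq_qt qb td bc_b (cycle_id d) ncy).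
(* Now t = p and r = q. If a and b commute, [a * b] is adjacent to c through a and to d through
   b. *)
have neq_pq: p != q by rewrite eq_qr.
have [cab | ncab] := commuteVP a b; last first.
  by exists [:: y]; rewrite /= (nn_adjI Gx Gy neq_pq pa qb xa yb ncab).
have [ab_a ab_b] := prod_cycle_mem neq_pq pa qb cab.
exists [:: c; a * b; d; y]; rewrite /= adjxc adjdy !andbT; split=> //.
rewrite nn_adj_sym (nn_adjI (groupM Ga Gb) Gc neq_pr pa rc ab_a (cycle_id c) ncx).
by rewrite (nn_adjI (groupM Ga Gb) Gd neq_qt qb td ab_b (cycle_id d) ncy).
Qed.

Lemma nonnil_vertices : ~~ nilpotent G -> G :\: nil G != set0.
Proof.
apply: contraNneq => V0.
have nilG x y : x \in G -> y \in G -> nilpotent <<[set x; y]>>.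
  move=> Gx Gy; have: x \notin G :\: nil G by rewrite V0 inE.
  by rewrite !inE Gx andbT negbK /= => /forall_inP->.
suffices /nilpotentS: G \subset 'F(G) by apply; apply: Fitting_nil.
apply/subsetP => x Gx; apply: constt_mem_group => p _.
have nO: 'O_p(p'_cent G p) \subset 'F(G).
  by rewrite Fitting_max ?p'_cent_pcore_normal ?(pgroup_nil (pcore_pgroup _ _)).
apply/(subsetP nO)/p'_cent_constt; rewrite inE groupX //=.
apply/centP => z; rewrite inE => /andP[Gz p'z].
apply/eqP; apply: contraTT (nilG _ _ Gx Gz) => /eqP nc.
apply: (nonnil_of_noncommuting (p_elt_constt p x) p'z _ _ nc).
  by rewrite groupX // mem_gen ?inE ?eqxx.
by rewrite mem_gen ?inE ?eqxx ?orbT.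
Qed.

End NonNilpotentPaths.

Theorem theorem5p1 (gT : finGroupType) (G : {group gT}) (hG : ~~ nilpotent G) :
  [/\ connected (nn_graph G),
      (diameter (nn_graph G) <= 6)%N
    & {in vertices (nn_graph G) &, forall x y : gT,
        ~ (\pi(#[x]) =i \pi(#[y])) ->
        exists2 p : seq gT, gpath (nn_graph G) x y p & (size p <= 4)%N}].
Proof.
split; last by move=> x y Vx Vy _; apply: short_path.
  split=> [|x y Vx Vy]; first exact: nonnil_vertices.
  by have [p xyp _] := short_path Vx Vy; exists p.
apply/bigmax_leqP => x Vx; apply/bigmax_leqP => y Vy.
by have [p xyp p4] := short_path Vx Vy; apply: dist_le xyp (leq_trans p4 _).
Qed.
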